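(* Let $\mathbb C\{x\}=\mathbb C\{x_1,\dots,x_d\}$ be the ring of convergent power series, and let $f,g\in\mathbb C[x]$ with $f(\mathbf 0)=g(\mathbf 0)=0$. Suppose $f$ is contact equivalent to $g$ at $\mathbf 0$, i.e. there exist a $\mathbb C$-algebra automorphism $\varphi$ of $\mathbb C\{x\}$ and a unit $u\in\mathbb C\{x\}$ with $g=u\cdot\varphi(f)$. Then for every integer $n\geq 1$, the $\mathbb C$-algebras $\mathbb C\{x\}/\langle f,\mathcal J_n(f)\rangle$ and $\mathbb C\{x\}/\langle g,\mathcal J_n(g)\rangle$ are isomorphic.
   Context: Multi-index notation: for $\alpha,\beta\in\mathbb N^d$, $|\alpha|=\sum\alpha_i$, $\alpha!=\prod\alpha_i!$, $\alpha\geq\beta$ means $\alpha_i\ge\beta_i$ for all $i$, $\alpha>\beta$ means $\alpha\ge\beta$ and $\alpha\neq\beta$, and $\partial^\alpha f=\partial^{|\alpha|}f/\partial x_1^{\alpha_1}\cdots\partial x_d^{\alpha_d}$. For $h\in\mathbb C\{x\}$ and $n\geq1$, the $n$-th Jacobian matrix $\mathrm{Jac}_n(h)$ is the matrix with rows indexed by $\beta\in\mathbb N^d$ with $0\le|\beta|\le n-1$ and columns indexed by $\alpha\in\mathbb N^d$ with $1\le|\alpha|\le n$ (both in graded lexicographic order), whose $(\beta,\alpha)$-entry is $\partial^{\alpha-\beta}h/(\alpha-\beta)!$ if $\alpha>\beta$, and $0$ otherwise. It has $\binom{d-1+n}{d}$ rows and $\binom{d+n}{d}-1$ columns. $\mathcal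 J_n(h)$ denotes the ideal of $\mathbb C\{x\}$ generated by all maximal minors (of size $\binom{d-1+n}{d}$) of $\mathrm{Jac}_n(h)$ (the $n$-th Jacobian ideal of $h$). *)

(* Defs.v *)
From HB Require Import structures.
From mathcomp Require Import all_boot all_order all_algebra.
From mathcomp Require Import Rstruct.
From mathcomp.real_closed Require Import complex.
From mathcomp.multinomials Require Import mpoly.
Set Implicit Arguments. Unset Strict Implicit. Unset Printing Implicit Defensive.
Import GRing.Theory Num.Theory.
Local Open Scope ring_scope.

Definition CC : numClosedFieldType := (Rdefinitions.R)[i].

Definition ps (d : nat) := 'X_{1..d} -> CC.

Section PS.
Variable d : nat.
Implicit Types (a b : ps d) (c : CC).

(* Convergent power series: coefficients grow at most geometrically,
   i.e. |a_m| r^|m| <= M for some r > 0 (this is exactly convergence of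
   the series on some polydisc around 0). *)
Definition convergent a : Prop :=
  exists r M : CC, 0 < r /\ forall m : 'X_{1..d}, `|a m| * r ^+ mdeg m <= M.

Definition ps0 : ps d := fun _ => 0.
Definition ps1 : ps d := fun m => if m == 0%MM then 1 else 0.
Definition psadd a b : ps d := fun m => a m + b m.
Definition psopp a : ps d := fun m => - a m.
Definition pssub a b : ps d := psadd a (psopp b).
Definition psscale c a : ps d := fun m => c * a m.
Definition psmul a b : ps d :=
  fun m => \sum_(m1 : 'X_{1..d < (mdeg m).+1} | (bmnm m1 <= m)%MM)
             a (bmnm m1) * b (m - bmnm m1)%MM.

Definition ps_of_poly (p : {mpoly CC[d]}) : ps d := fun m => p@_m.

Definition cps_automorphism (phi : ps d -> ps d) : Prop :=
  (forall a, convergent a -> convergent (phi a)) /\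
  (forall a b, convergent a -> convergent b ->
        phi (psadd a b) = psadd (phi a) (phi b)) /\
  (forall a b, convergent a -> convergent b ->
        phi (psmul a b) = psmul (phi a) (phi b)) /\
  (forall c a, convergent a -> phi (psscale c a) = psscale c (phi a)) /\
  phi ps1 = ps1 /\
  (forall a b, convergent a -> convergent b -> phi a = phi b -> a = b) /\
  (forall b, convergent b -> exists2 a, convergent a & phi a = b).

Definition cps_unit u : Prop :=
  convergent u /\ exists2 v, convergent v & psmul u v = ps1.

Definition ideal_gen (gens : seq (ps d)) (a : ps d) : Prop :=
  exists2 cs : seq (ps d), size cs = size gens /\ (forall k, (k < size cs)%N -> convergent (nth ps0 cs k))
    & a = foldr (fun pq acc => psadd (psmul pq.1 pq.2) acc) ps0 (zip cs gens).

(* The quotient C-algebras C{x}/I and C{x}/J are isomorphic: a map on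
   representatives inducing a well-defined bijective C-algebra morphism of
   the quotients. *)
Definition quotient_algebras_iso (I J : ps d -> Prop) : Prop :=
  exists Psi : ps d -> ps d,
  (forall a, convergent a -> convergent (Psi a)) /\
  (forall a a', convergent a -> convergent a' ->
        I (pssub a a') -> J (pssub (Psi a) (Psi a'))) /\
  (forall a b, convergent a -> convergent b ->
        J (pssub (Psi (psadd a b)) (psadd (Psi a) (Psi b)))) /\
  (forall a b, convergent a -> convergent b ->
        J (pssub (Psi (psmul a b)) (psmul (Psi a) (Psi b)))) /\
  (forall c a, convergent a ->
        J (pssub (Psi (psscale c a)) (psscale c (Psi a)))) /\
  J (pssub (Psi ps1) ps1) /\
  (forall a a', convergent a -> convergent a' ->
        J (pssub (Psi a) (Psi a')) -> I (pssub a a')) /\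
  (forall b, convergent b -> exists2 a, convergent a & J (pssub (Psi a) b)).

Definition mfact (m : 'X_{1..d}) : nat := \prod_(i < d) (m i)`!.

Definition jac_row (n : nat) := 'X_{1..d < n}.
Definition jac_col (n : nat) := {m : 'X_{1..d < n.+1} | (0 < mdeg (bmnm m))%N}.

Definition jac_entry (h : {mpoly CC[d]}) (beta alpha : 'X_{1..d}) : {mpoly CC[d]} :=
  if (beta < alpha)%MM then
    ((mfact (alpha - beta)%MM)%:R)^-1 *: mderivm (alpha - beta)%MM h
  else 0.

Definition Jac (n : nat) (h : {mpoly CC[d]}) :
  'M[{mpoly CC[d]}]_(#|{: jac_row n}|, #|{: jac_col n}|) :=
  \matrix_(i, j) jac_entry h (bmnm (enum_val i : jac_row n))
                             (bmnm (val (enum_val j : jac_col n))).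

Definition max_minors (n : nat) (h : {mpoly CC[d]}) : seq {mpoly CC[d]} :=
  [seq \det (colsub (fun i => (s : {ffun 'I_#|{: jac_row n}| -> 'I_#|{: jac_col n}|}) i) (Jac n h)) |
     s <- enum [pred s : {ffun 'I_#|{: jac_row n}| -> 'I_#|{: jac_col n}|} |
                [forall i : 'I_#|{: jac_row n}|, forall j : 'I_#|{: jac_row n}|,
                   (i < j)%N ==> (s i < s j)%N]]].

Definition f_jac_ideal (n : nat) (f : {mpoly CC[d]}) : ps d -> Prop :=
  ideal_gen (map ps_of_poly (f :: max_minors n f)).

End PS.

(* Main.v *)
(* Attach to h its Taylor jet T(h) = sum_g (d^g h / g!) e^g, so that row b of
   Jac_n(h) lists the coefficients of e^b (T(h) - h) modulo e^(n+1).  The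
   automorphism phi induces a morphism Phi of jets, phi on coefficients and
   e_i |-> T(phi x_i) - phi x_i, with T(phi h) = Phi(T h); Phi is surjective
   because phi is invertible.  For g = u phi(f) one finds
     T(g) - g = T(u) Phi(T(f) - f)   modulo phi(f),
   hence Jac_n(g) = C phi(Jac_n(f)) E modulo phi(f) for suitable matrices C, E,
   and by Cauchy-Binet the ideal <g, J_n(g)> is contained in the ideal generated
   by phi <f, J_n(f)>.  The hypothesis being symmetric in f and g, phi carries
   one ideal onto the other. *)
Require Import Defs.
From HB Require Import structures.
From mathcomp Require Import all_boot all_order all_fingroup all_algebra.
From mathcomp Require Import boolp ring zify.
From mathcomp.multinomials Require Import mpoly.
Import Order.TTheory GRing.Theory Num.Theory.
Set Implicit Arguments. Unset Strict Implicit. Unset Printing Implicit Defensive.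
Local Open Scope ring_scope.

(* Left transparent, CC is unfolded to its structure record by unification, and
   rewriting with the generic number-field lemmas fails. *)
Opaque CC.

(** * Power series as a ring *)

Section TruncEq.
Variables (d : nat) (R : comNzRingType).
Implicit Types p q : {mpoly R[d]}.

(** Congruence modulo the N-th power of the ideal of the variables. It stands in for a quotient
    ring, so that jets remain ordinary polynomials. *)
Definition eqtrunc N p q := forall m, (mdeg m < N)%N -> p@_m = q@_m.

Lemma eqtrunc_refl N p : eqtrunc N p p. Proof. by []. Qed.

Lemma eqtrunc_sym N p q : eqtrunc N p q -> eqtrunc N q p.
Proof. by move=> h m /h. Qed.

Lemma eqtrunc_trans N q p r : eqtrunc N p q -> eqtrunc N q r -> eqtrunc N p r.
Proof. by move=> h1 h2 m hm; rewrite h1 ?h2. Qed.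

Lemma eqtruncD N p p' q q' :
  eqtrunc N p p' -> eqtrunc N q q' -> eqtrunc N (p + q) (p' + q').
Proof. by move=> h1 h2 m hm; rewrite !mcoeffD h1 ?h2. Qed.

Lemma eqtruncB N p p' q q' :
  eqtrunc N p p' -> eqtrunc N q q' -> eqtrunc N (p - q) (p' - q').
Proof. by move=> h1 h2 m hm; rewrite !mcoeffB h1 ?h2. Qed.

Lemma eqtruncM N p p' q q' :
  eqtrunc N p p' -> eqtrunc N q q' -> eqtrunc N (p * q) (p' * q').
Proof.
move=> h1 h2 m hm; rewrite !mcoeffM; apply: eq_bigr => -[k1 k2] _ /=.
by rewrite h1 ?h2 //; apply: leq_trans hm; apply: bmdeg.
Qed.

Lemma eqtrunc_sum N (I : Type) (r : seq I) (P : pred I) F G :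
  (forall i, P i -> eqtrunc N (F i) (G i)) ->
  eqtrunc N (\sum_(i <- r | P i) F i) (\sum_(i <- r | P i) G i).
Proof.
move=> h; apply: (big_ind2 (eqtrunc N)) => // *.
exact: eqtruncD.
Qed.

Lemma mcoeffXM p m k :
  ('X_[m] * p)@_k = if (m <= k)%MM then p@_(k - m) else 0.
Proof.
rewrite (@mcoeff_poly_mul_lin _ _ _ _ _ (mdeg k + mdeg m).+1); last first.
  by rewrite ltnS leq_addr.
have hm : (mdeg m < (mdeg k + mdeg m).+1)%N by rewrite ltnS leq_addl.
rewrite big_mkcond (bigD1 (BMultinom hm)) //= big1 ?addr0.
  by rewrite mcoeffX eqxx mul1r.
move=> [j hj] /=; rewrite bmeqP /= => njm; case: ifP => // _.
by rewrite mcoeffX eq_sym (negPf njm) mul0r.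
Qed.

End TruncEq.
Arguments eqtrunc_refl {d R N p}.

Section Truncation.
Variable d : nat.
Implicit Types (a b c : ps d) (p q : {mpoly CC[d]}).

Definition pstrunc N a : {mpoly CC[d]} := \sum_(m : 'X_{1..d < N}) a m *: 'X_[m].

Lemma mcoeff_pstrunc N a m : (mdeg m < N)%N -> (pstrunc N a)@_m = a m.
Proof. exact: mcoeff_mpoly. Qed.

(** A coefficient of a product involves only coefficients of lower or equal degree. By truncation,
    the ring laws of series thus follow from those of polynomials. *)
Lemma psmul_mcoeff N a b p q m :
  (forall k, (mdeg k < N)%N -> p@_k = a k) ->
  (forall k, (mdeg k < N)%N -> q@_k = b k) ->
  (mdeg m < N)%N -> psmul a b m = (p * q)@_m.
Proof.
move=> hp hq hm; rewrite /psmul (@mcoeff_poly_mul_lin _ _ _ _ _ (mdeg m).+1) //.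
apply: eq_bigr => k _; rewrite hp ?hq //.
  by apply: leq_ltn_trans hm; apply: mdegB.
by apply: leq_trans hm; apply: bmdeg.
Qed.

Lemma psmulE N a b m : (mdeg m < N)%N ->
  psmul a b m = (pstrunc N a * pstrunc N b)@_m.
Proof. by move=> hm; apply: (psmul_mcoeff (N := N)) => // k hk; exact: mcoeff_pstrunc. Qed.

Lemma pstrunc_psmul N a b :
  eqtrunc N (pstrunc N (psmul a b)) (pstrunc N a * pstrunc N b).
Proof. by move=> m hm; rewrite mcoeff_pstrunc // -psmulE. Qed.

Lemma psmulC : commutative (@psmul d).
Proof.
move=> a b; apply/funext => m.
by rewrite !(@psmulE (mdeg m).+1) // mulrC.
Qed.

Lemma psmulA : associative (@psmul d).
Proof.
move=> a b c; apply/funext => m; have hm := ltnSn (mdeg m).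
rewrite !(psmulE _ _ hm).
rewrite (eqtruncM (eqtrunc_refl) (pstrunc_psmul b c)) //.
by rewrite (eqtruncM (pstrunc_psmul a b) (eqtrunc_refl)) // mulrA.
Qed.

Lemma pstruncD N a b : pstrunc N (psadd a b) = pstrunc N a + pstrunc N b.
Proof.
by rewrite -big_split; apply: eq_bigr => m _; apply: scalerDl.
Qed.

Lemma psmulDl : left_distributive (@psmul d) (@psadd d).
Proof.
move=> a b c; apply/funext => m; have hm := ltnSn (mdeg m).
by rewrite /psadd !(psmulE _ _ hm) pstruncD mulrDl mcoeffD.
Qed.

Lemma mcoeff1_ps m : (1 : {mpoly CC[d]})@_m = @ps1 d m.
Proof. by rewrite mcoeff1 /ps1; case: ifP. Qed.

Lemma psmul1l : left_id (@ps1 d) (@psmul d).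
Proof.
move=> a; apply/funext => m; have hm := ltnSn (mdeg m).
rewrite (@psmul_mcoeff (mdeg m).+1 _ _ 1 (pstrunc (mdeg m).+1 a)) //.
- by rewrite mul1r mcoeff_pstrunc.
- by move=> k _; rewrite mcoeff1_ps.
- by move=> k; apply: mcoeff_pstrunc.
Qed.

Lemma psaddA : associative (@psadd d).
Proof. by move=> a b c; apply/funext => m; rewrite /psadd addrA. Qed.
Lemma psaddC : commutative (@psadd d).
Proof. by move=> a b; apply/funext => m; rewrite /psadd addrC. Qed.
Lemma psadd0 : left_id (@ps0 d) (@psadd d).
Proof. by move=> a; apply/funext => m; rewrite /psadd add0r. Qed.
Lemma psaddN : left_inverse (@ps0 d) (@psopp d) (@psadd d).
Proof. by move=> a; apply/funext => m; rewrite /psadd /psopp addNr. Qed.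
Lemma ps1_neq0 : @ps1 d != @ps0 d.
Proof.
apply/eqP => /(congr1 (fun a => a 0%MM)); rewrite /ps1 /ps0 eqxx => /eqP.
by rewrite oner_eq0.
Qed.
End Truncation.

HB.instance Definition _ d := gen_eqMixin (ps d).
HB.instance Definition _ d := gen_choiceMixin (ps d).
HB.instance Definition _ d :=
  GRing.isZmodule.Build (ps d) (@psaddA d) (@psaddC d) (@psadd0 d) (@psaddN d).
HB.instance Definition _ d :=
  GRing.Zmodule_isComNzRing.Build (ps d) (@psmulA d) (@psmulC d)
    (@psmul1l d) (@psmulDl d) (@ps1_neq0 d).

(** * Polynomials as series, and estimates for convergence *)

Section PsTheory.
Variable d : nat.
Implicit Types (a b c : ps d) (p q : {mpoly CC[d]}).

Lemma psBE a b m : (a - b) m = a m - b m. Proof. by []. Qed.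
Lemma ps1E m : (1 : ps d) m = (m == 0%MM)%:R.
Proof. by rewrite -[LHS]/(@ps1 d m) -mcoeff1_ps mcoeff1. Qed.

Lemma ps_of_poly_is_zmod_morphism : zmod_morphism (@ps_of_poly d).
Proof. by move=> p q; apply/funext => m; rewrite psBE /ps_of_poly mcoeffB. Qed.
Lemma ps_of_poly_is_monoid_morphism : monoid_morphism (@ps_of_poly d).
Proof.
split=> [|p q]; apply/funext => m; first by rewrite ps1E /ps_of_poly mcoeff1.
by rewrite /ps_of_poly -(@psmul_mcoeff _ (mdeg m).+1 (ps_of_poly p) (ps_of_poly q)).
Qed.
HB.instance Definition _ := GRing.isZmodMorphism.Build _ _ (@ps_of_poly d)
  ps_of_poly_is_zmod_morphism.
HB.instance Definition _ := GRing.isMonoidMorphism.Build _ _ (@ps_of_poly d)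
  ps_of_poly_is_monoid_morphism.

Lemma psXME p a m : psmul (ps_of_poly p) a m = (p * pstrunc (mdeg m).+1 a)@_m.
Proof. by apply: (psmul_mcoeff (N := (mdeg m).+1)) => // k hk; rewrite mcoeff_pstrunc. Qed.

Lemma mul_psX i a m :
  (ps_of_poly 'X_i * a) m = if m i == 0%N then 0 else a (m - U_(i))%MM.
Proof.
rewrite [LHS]psXME mcoeffXM lep1mP; case: eqP => //= _.
by rewrite mcoeff_pstrunc // ltnS mdegB.
Qed.

Lemma mul_psC (x : CC) a : ps_of_poly x%:MP * a = psscale x a.
Proof.
apply/funext => m; rewrite [LHS]psXME mcoeffCM mcoeff_pstrunc //.
Qed.

Lemma convergentP a :
  convergent a <-> exists M r : CC, [/\ 0 < M, 1 <= r & forall m, `|a m| <= M * r ^+ mdeg m].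
Proof.
split=> [[r [M [r0 h]]]|[M [r [M0 r1 h]]]].
  have r0' := ltW r0.
  have M0 : 0 <= M by apply: le_trans (h 0%MM); rewrite mulr_ge0 // exprn_ge0.
  (* [M] is only known to be nonnegative and [r^-1] may lie below 1; adding 1 repairs both. *)
  exists (M + 1), (r^-1 + 1); split.
  - by rewrite ltr_wpDl.
  - by rewrite lerDr invr_ge0.
  move=> m; apply: (@le_trans _ _ (M * r^-1 ^+ mdeg m)).
    by rewrite exprVn ler_pdivlMr ?exprn_gt0.
  apply: ler_pM => //; first by rewrite exprn_ge0 ?invr_ge0.
    by rewrite lerDl.
  by rewrite lerXn2r ?nnegrE ?addr_ge0 ?invr_ge0 // lerDl.
have r0 : 0 < r by apply: lt_le_trans r1.
exists r^-1, M; split; first by rewrite invr_gt0.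
by move=> m; rewrite exprVn ler_pdivrMr ?exprn_gt0.
Qed.

Lemma convergent2P a b : convergent a -> convergent b ->
  exists M r : CC, [/\ 0 < M, 1 <= r, forall m, `|a m| <= M * r ^+ mdeg m
    & forall m, `|b m| <= M * r ^+ mdeg m].
Proof.
move=> /convergentP[M [r [M0 r1 h]]] /convergentP[M' [r' [M0' r1' h']]].
have r0 : 0 <= r by apply: le_trans r1.
have r0' : 0 <= r' by apply: le_trans r1'.
have M0w := ltW M0; have M0w' := ltW M0'.
exists (M + M'), (r + r'); split.
- by rewrite addr_gt0.
- by apply: le_trans r1 _; rewrite lerDl.
- move=> m; apply: (le_trans (h m)); apply: ler_pM => //.
  + by rewrite exprn_ge0. + by rewrite lerDl.
  by rewrite lerXn2r ?nnegrE ?addr_ge0 // lerDl.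
- move=> m; apply: (le_trans (h' m)); apply: ler_pM => //.
  + by rewrite exprn_ge0. + by rewrite lerDr.
  by rewrite lerXn2r ?nnegrE ?addr_ge0 // lerDr.
Qed.

Lemma convergent_sub a b : convergent a -> convergent b -> convergent (a - b).
Proof.
move=> ca cb; have [M [r [M0 r1 ha hb]]] := convergent2P ca cb.
apply/convergentP; exists (M + M), r; split=> //; first by rewrite addr_gt0.
move=> m; rewrite psBE mulrDl; apply: le_trans (ler_normB _ _) _.
by apply: lerD.
Qed.

(** Each exponent is at most [n], and (n+1)^d <= 2^(dn). The bound is exponential in [n] so that
    geometric growth can absorb it. *)
Lemma card_bmultinom n : (#|{: 'X_{1..d < n.+1}}| <= 2 ^ (d * n))%N.
Proof.
pose f (k : 'X_{1..d < n.+1}) : {ffun 'I_d -> 'I_n.+1} := [ffun i => inord (bmnm k i)].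
have hk (k : 'X_{1..d < n.+1}) i : (bmnm k i < n.+1)%N.
  by apply: leq_ltn_trans (bmdeg k); rewrite mdegE (bigD1 i) //= leq_addr.
have finj : injective f.
  move=> k1 k2 /ffunP h; apply/val_inj/mnmP => i.
  by have := congr1 val (h i); rewrite !ffunE /= !inordK.
apply: leq_trans (leq_card f finj) _.
rewrite card_ffun !card_ord mulnC expnM.
by elim: d => // d' IH; rewrite !expnS leq_mul // ltn_expl.
Qed.

Lemma convergent_mul a b : convergent a -> convergent b -> convergent (a * b).
Proof.
move=> ca cb; have [M [r [M0 r1 ha hb]]] := convergent2P ca cb.
have r0 : 0 < r by apply: lt_le_trans r1.
(* The factor [2 ^+ d] pays for the number of terms of the Cauchy product, at most 2^(d|m|). *)
apply/convergentP; exists (M * M), (2 ^+ d * r); split.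
- by rewrite mulr_gt0.
- have h1 : 1 <= (2 ^+ d : CC) by rewrite exprn_ege1 ?ler1n.
  exact: mulr_ege1.
move=> m; apply: le_trans (ler_norm_sum _ _ _) _.
apply: (@le_trans _ _ (\sum_(k : 'X_{1..d < (mdeg m).+1}) (M * M * r ^+ mdeg m))).
  rewrite big_mkcond /=; apply: ler_sum => k _.
  case: ifP => [/submK hk|_]; last first.
    by rewrite !mulr_ge0 ?exprn_ge0 // ltW.
  have -> : M * M * r ^+ mdeg m = (M * r ^+ mdeg k) * (M * r ^+ mdeg (m - k)).
    by rewrite mulrACA -exprD -mdegD addmC hk.
  by rewrite normrM ler_pM.
rewrite sumr_const -[X in X <= _]mulr_natl exprMn -exprM mulrCA.
rewrite ler_wpM2l ?mulr_ge0 ?(ltW M0) //.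
by rewrite ler_wpM2r ?exprn_ge0 ?(ltW r0) // -natrX ler_nat card_bmultinom.
Qed.

Lemma convergent_poly p : convergent (ps_of_poly p).
Proof.
apply/convergentP; exists (1 + \sum_(m <- msupp p) `|p@_m|), 1; split=> //.
  by rewrite ltr_wpDr ?sumr_ge0.
move=> m; rewrite expr1n mulr1 /ps_of_poly.
have [mp|] := boolP (m \in msupp p); last first.
  by move/memN_msupp_eq0 => ->; rewrite normr0 addr_ge0 ?sumr_ge0.
rewrite (perm_big _ (perm_to_rem mp)) big_cons /= addrCA.
by rewrite lerDl addr_ge0 ?sumr_ge0.
Qed.
End PsTheory.

(** * The ring of convergent power series *)

Definition convergentb d : {pred ps d} := fun a => `[<convergent a>].

Lemma convergentb_subring d : subring_closed (@convergentb d).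
Proof.
split; rewrite /convergentb /in_mem /=.
- apply/asboolP; rewrite -(rmorph1 (@ps_of_poly d)).
  exact: convergent_poly.
- by move=> a b /asboolP ha /asboolP hb; apply/asboolP/convergent_sub.
- by move=> a b /asboolP ha /asboolP hb; apply/asboolP/convergent_mul.
Qed.
HB.instance Definition _ d :=
  GRing.isSubringClosed.Build (ps d) (@convergentb d) (@convergentb_subring d).

Record cps d := Cps { cpsval : ps d; cpsvalP : cpsval \in @convergentb d }.
HB.instance Definition _ d := [isSub for @cpsval d].
HB.instance Definition _ d := [Choice of cps d by <:].
HB.instance Definition _ d := [SubChoice_isSubComNzRing of cps d by <:].

Section CpsTheory.
Variable d : nat.
Implicit Types (a b : cps d) (p q : {mpoly CC[d]}).

Definition mkcps (a : ps d) (ha : convergent a) : cps d := Cps (asboolT ha).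

Lemma cps_convergent a : convergent (val a).
Proof. by apply/asboolP; exact: (valP a). Qed.

Lemma cps_coefP a b : (forall m, val a m = val b m) -> a = b.
Proof. by move=> h; apply/val_inj/funext. Qed.

Lemma cpsDE a b m : val (a + b) m = val a m + val b m.
Proof. by []. Qed.

Lemma cpsBE a b m : val (a - b) m = val a m - val b m.
Proof. by []. Qed.

Lemma cps1E m : val (1 : cps d) m = (m == 0%MM)%:R.
Proof. exact: ps1E. Qed.

Lemma cps_sumE (I : Type) (r : seq I) (P : pred I) (F : I -> cps d) m :
  val (\sum_(i <- r | P i) F i) m = \sum_(i <- r | P i) val (F i) m.
Proof. by elim/big_rec2: _ => // i x y _ <-. Qed.

Lemma cpsME a b : val (a * b) = psmul (val a) (val b).
Proof. by rewrite rmorphM. Qed.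

Definition cps_of_poly p : cps d := mkcps (convergent_poly p).

Lemma cps_of_poly_is_zmod_morphism : zmod_morphism cps_of_poly.
Proof. by move=> p q; apply/val_inj; rewrite rmorphB /= rmorphB. Qed.
Lemma cps_of_poly_is_monoid_morphism : monoid_morphism cps_of_poly.
Proof.
by split=> [|p q]; apply/val_inj; rewrite /= ?rmorph1 // !rmorphM.
Qed.
HB.instance Definition _ := GRing.isZmodMorphism.Build _ _ cps_of_poly
  cps_of_poly_is_zmod_morphism.
HB.instance Definition _ := GRing.isMonoidMorphism.Build _ _ cps_of_poly
  cps_of_poly_is_monoid_morphism.

Definition cpsC (x : CC) : cps d := cps_of_poly x%:MP.
Definition cpsX (i : 'I_d) : cps d := cps_of_poly 'X_i.

Lemma cpsC_is_zmod_morphism : zmod_morphism cpsC.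
Proof. by move=> x y; rewrite /cpsC !rmorphB. Qed.
Lemma cpsC_is_monoid_morphism : monoid_morphism cpsC.
Proof. by split=> [|x y]; rewrite /cpsC ?rmorph1 // !rmorphM. Qed.
HB.instance Definition _ := GRing.isZmodMorphism.Build _ _ cpsC
  cpsC_is_zmod_morphism.
HB.instance Definition _ := GRing.isMonoidMorphism.Build _ _ cpsC
  cpsC_is_monoid_morphism.

Lemma val_cpsCM x a m : val (cpsC x * a) m = x * val a m.
Proof. by rewrite rmorphM /= mul_psC. Qed.

Lemma val_cpsXM i a m :
  val (cpsX i * a) m = if m i == 0%N then 0 else val a (m - U_(i))%MM.
Proof. by rewrite rmorphM /= mul_psX. Qed.

Lemma val_cpsX i m : val (cpsX i) m = (U_(i)%MM == m)%:R.
Proof. exact: mcoeffX. Qed.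

Lemma val_cpsC x m : val (cpsC x) m = x * (m == 0%MM)%:R.
Proof. exact: mcoeffC. Qed.

(* Euler's formula: weighting the i-th shifted coefficient by m_i/|m| makes the
   sum of the X_i h_i equal h without any choice of a variable dividing x^m. *)
Definition pscofactor i (a : ps d) : ps d :=
  fun m => a (m + U_(i))%MM * (m i).+1%:R / (mdeg m).+1%:R.

Lemma le_mdeg (m : 'X_{1..d}) i : (m i <= mdeg m)%N.
Proof. by rewrite mdegE (bigD1 i) //= leq_addr. Qed.

Lemma mdeg_subU (m : 'X_{1..d}) i : m i != 0%N -> mdeg m = (mdeg (m - U_(i))).+1.
Proof.
by move=> mi; rewrite -{1}(submK (m := U_(i)) (m' := m)) ?lep1mP // mdegD mdeg1 addn1.
Qed.

(** The factor 2^|m+k| makes room for the weights of [pscofactor] and the binomial coefficients of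
    [pshasse]; it only doubles the growth rate. *)
Lemma convergent_shift (a b : ps d) (k : 'X_{1..d}) :
  convergent a ->
  (forall m, `|b m| <= 2 ^+ mdeg (m + k) * `|a (m + k)%MM|) -> convergent b.
Proof.
move=> /convergentP[M [r [M0 r1 h]]] hb; apply/convergentP.
have r0 : 0 < r by apply: lt_le_trans r1.
exists (2 ^+ mdeg k * (M * r ^+ mdeg k)), (2 * r); split.
- by rewrite !mulr_gt0 // exprn_gt0.
- by rewrite mulr_ege1 // ler1n.
move=> m; apply: le_trans (hb m) _; apply: le_trans (ler_wpM2l _ (h _)) _.
  by rewrite exprn_ge0.
rewrite mdegD !exprD exprMn.
by rewrite le_eqVlt; apply/orP; left; apply/eqP; ring.
Qed.

Lemma convergent_cofactor i (a : ps d) : convergent a -> convergent (pscofactor i a).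
Proof.
move=> ha; apply: (convergent_shift (k := U_(i)) ha) => m.
have lem : (m i).+1%:R <= (mdeg m).+1%:R :> CC by rewrite ler_nat ltnS le_mdeg.
rewrite /pscofactor !normrM normrV ?unitfE ?pnatr_eq0 // !normr_nat -mulrA mulrC.
rewrite ler_wpM2r ?normr_ge0 // ler_pdivrMr ?ltr0Sn //.
apply: le_trans lem _; rewrite ler_peMl ?ler0n // exprn_ege1 ?ler1n //.
Qed.

Definition cps_cofactor i a : cps d := mkcps (convergent_cofactor i (cps_convergent a)).

(** An explicit form of the fact that the variables generate the maximal ideal; it drives the
    induction in [jetmap_taylor]. *)
Lemma cps_decompose a :
  a = cpsC (val a 0%MM) + \sum_i cpsX i * cps_cofactor i a.
Proof.
apply: cps_coefP => m; rewrite cpsDE cps_sumE val_cpsC.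
have [->|m0] := eqVneq m 0%MM.
  rewrite mulr1 big1 ?addr0 // => i _.
  by rewrite val_cpsXM mnm0E eqxx.
rewrite mulr0 add0r (eq_bigr (fun i => val a m * ((m i)%:R / (mdeg m)%:R))) => [|i _].
  rewrite -mulr_sumr -mulr_suml -natr_sum -mdegE divff ?mulr1 //.
  by rewrite pnatr_eq0 mdeg_eq0.
rewrite val_cpsXM.
case: eqP => [->|/eqP mi]; first by rewrite mul0r mulr0.
rewrite /= /pscofactor submK ?lep1mP // mnmBE mnm1E eqxx subn1 prednK ?lt0n //.
by rewrite (mdeg_subU mi) mulrA.
Qed.

(* The coefficients of the geometric series of 1/(X_i - c). *)
Definition psgeom i (c : CC) : ps d :=
  fun m => if mdeg m == m i then - c^-1 ^+ (m i).+1 else 0.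

Lemma convergent_geom i c : convergent (psgeom i c).
Proof.
apply/convergentP; exists (`|c^-1| + 1), (`|c^-1| + 1).
have h1 : 1 <= `|c^-1| + 1 by rewrite lerDr.
split=> // [|m]; first by apply: lt_le_trans h1.
rewrite -exprS /psgeom; case: eqP => [->|_]; last first.
  by rewrite normr0 exprn_ge0 // addr_ge0.
by rewrite normrN normrX lerXn2r ?nnegrE ?addr_ge0 // lerDl.
Qed.

Lemma cps_geom i c : c != 0 ->
  (cpsX i - cpsC c) * mkcps (convergent_geom i c) = 1.
Proof.
move=> c0; apply: cps_coefP => m; rewrite mulrBl cpsBE val_cpsXM val_cpsCM cps1E /= /psgeom.
case: eqP => [mi0|/eqP mi].
  rewrite mi0 sub0r mdeg_eq0; case: eqP => _; last by rewrite mulr0 oppr0.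
  by rewrite mulrN opprK expr1 divff.
have m0 : m != 0%MM by apply: contraNneq mi => ->; rewrite mnm0E.
have em : m i = ((m - U_(i))%MM i).+1.
  by rewrite mnmBE mnm1E eqxx subn1 prednK ?lt0n.
rewrite (negPf m0) (mdeg_subU mi) em eqSS; case: eqP => _; last by rewrite mulr0 subr0.
by rewrite mulrN opprK [_ ^+ _.+2]exprS mulrA divff // mul1r addNr.
Qed.
End CpsTheory.

(** * Hasse derivatives and Taylor jets *)

Section Taylor.
Variable d : nat.
Implicit Types (a b : cps d) (g m : 'X_{1..d}).

Definition mbin m g : nat := \prod_i 'C(m i, g i).

Lemma leq_bin_exp n k : ('C(n, k) <= 2 ^ n)%N.
Proof.
have [kn|nk] := leqP k n; last by rewrite bin_small.
rewrite -[2%N]/(1 + 1)%N expnDn (bigD1 (Ordinal (n := n.+1) (m := k) kn)) //=.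
by rewrite !exp1n !muln1 leq_addr.
Qed.

Lemma mbin_le m g : (mbin m g <= 2 ^ mdeg m)%N.
Proof.
rewrite mdegE expn_sum; apply: leq_prod => i _; exact: leq_bin_exp.
Qed.

(** The divided derivative of order g, that is, the partial derivative divided by g!; binomial
    coefficients avoid the division. *)
Definition pshasse g (a : ps d) : ps d := fun m => (mbin (m + g) g)%:R * a (m + g)%MM.

Lemma convergent_hasse g (a : ps d) : convergent a -> convergent (pshasse g a).
Proof.
move=> ha; apply: (convergent_shift (k := g) ha) => m.
by rewrite normrM normr_nat ler_wpM2r // -natrX ler_nat mbin_le.
Qed.

Definition cps_hasse g a : cps d := mkcps (convergent_hasse g (cps_convergent a)).

Lemma val_hasse g a m : val (cps_hasse g a) m = (mbin (m + g) g)%:R * val a (m + g)%MM.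
Proof. by []. Qed.

Lemma cps_hasse_is_zmod_morphism g : zmod_morphism (cps_hasse g).
Proof. by move=> a b; apply: cps_coefP => m; rewrite cpsBE !val_hasse cpsBE mulrBr. Qed.
HB.instance Definition _ g := GRing.isZmodMorphism.Build _ _ (cps_hasse g)
  (cps_hasse_is_zmod_morphism g).

Lemma cps_hasse0 a : cps_hasse 0%MM a = a.
Proof.
apply: cps_coefP => m; rewrite val_hasse addm0 /mbin big1 ?mul1r // => i _.
by rewrite mnm0E bin0.
Qed.

Definition cps_deriv i a := cps_hasse U_(i)%MM a.

Lemma val_deriv i a m : val (cps_deriv i a) m = val a (m + U_(i))%MM *+ (m i).+1.
Proof.
rewrite val_hasse mulr_natl /mbin (bigD1 i) //= big1 ?muln1 => [|j ji].
  by rewrite mnmDE mnm1E eqxx bin1 addn1.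
by rewrite mnm1E eq_sym (negPf ji) bin0.
Qed.

(** In the i-th factor this is (k+1) C(n+1,k+1) = (n+1) C(n,k). The recursion on the order serves
    the induction in [taylorM]. *)
Lemma cps_hasseSr i g a :
  cps_hasse (g + U_(i))%MM a *+ (g i).+1 = cps_hasse g (cps_deriv i a).
Proof.
apply: cps_coefP => m.
have -> k x : val (x *+ k : cps d) m = val x m *+ k.
  by elim: k => [|k IH]; rewrite ?mulr0n ?mulrS // cpsDE IH.
rewrite [RHS]val_hasse val_deriv [in LHS]val_hasse addmA.
rewrite !mulr_natl -!mulrnA; congr (_ *+ _).
rewrite /mbin (bigD1 i) //= [in RHS](bigD1 i) //= mulnAC [in RHS]mulnA.
congr (_ * _)%N; last first.
  by apply: eq_bigr => j ji; rewrite !mnmDE mnm1E eq_sym (negPf ji) !addn0.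
by rewrite !mnmDE mnm1E eqxx !addn1 mul_bin_diag mulnC.
Qed.

Lemma cps_derivM i a b :
  cps_deriv i (a * b) = cps_deriv i a * b + a * cps_deriv i b.
Proof.
apply: cps_coefP => m; rewrite val_deriv cpsDE !cpsME.
(* Differentiation lowers degrees by one, so the truncation must keep degree |m|+1; the product rule
   is then that of polynomials. *)
set N := (mdeg m).+2.
have hm : (mdeg (m + U_(i)) < N)%N by rewrite mdegD mdeg1 addn1.
have hd x k : (mdeg k < (mdeg m).+1)%N ->
    (mderiv i (pstrunc N (val x)))@_k = val (cps_deriv i x) k.
  move=> hk; rewrite mcoeff_mderiv mcoeff_pstrunc ?val_deriv //.
  by rewrite mdegD mdeg1 addn1.
have hx (x : cps d) k : (mdeg k < (mdeg m).+1)%N -> (pstrunc N (val x))@_k = val x k.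
  by move=> hk; rewrite mcoeff_pstrunc // ltnW.
rewrite (psmulE _ _ hm) -mcoeff_mderiv mderivM mcoeffD; congr (_ + _).
  by symmetry; apply: (psmul_mcoeff (N := (mdeg m).+1)) => // k; [apply: hd|apply: hx].
by symmetry; apply: (psmul_mcoeff (N := (mdeg m).+1)) => // k; [apply: hx|apply: hd].
Qed.

(** Positive integers are invertible constants of the ring. *)
Lemma cps_mulrnI a b n : a *+ n.+1 = b *+ n.+1 -> a = b.
Proof.
move=> h; have inv : cpsC d (n.+1%:R^-1) * n.+1%:R = 1.
  by rewrite -(rmorph_nat (cpsC d)) -rmorphM mulVf ?pnatr_eq0 ?rmorph1.
by rewrite -[a]mul1r -[b]mul1r -inv -!mulrA !mulr_natl h.
Qed.

(** The expansion of a(x + e) below degree N in e; the outer polynomial variables are the increments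
    e. *)
Definition taylor N a : {mpoly (cps d)[d]} :=
  \sum_(g : 'X_{1..d < N}) cps_hasse g a *: 'X_[g].

Lemma mcoeff_taylor N a g : (mdeg g < N)%N -> (taylor N a)@_g = cps_hasse g a.
Proof. exact: (@mcoeff_mpoly _ _ (fun g => cps_hasse g a)). Qed.

Lemma taylor_is_zmod_morphism N : zmod_morphism (taylor N).
Proof.
move=> a b; rewrite -sumrB; apply: eq_bigr => g _.
by rewrite raddfB scalerBl.
Qed.
HB.instance Definition _ N := GRing.isZmodMorphism.Build _ _ (taylor N)
  (taylor_is_zmod_morphism N).

(* Both sides satisfy the differential equation d/de_i T(h) = T(dh/dx_i), which
   determines the coefficients recursively. *)
Lemma taylorM N a b : eqtrunc N (taylor N (a * b)) (taylor N a * taylor N b).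
Proof.
move=> g; move: {2}(mdeg g) (erefl (mdeg g)) => k.
elim: k g a b => [|k IH] g a b hg hN.
  move/eqP: hg; rewrite mdeg_eq0 => /eqP g0; subst g.
  by rewrite rmorphM /= !mcoeff_taylor // !cps_hasse0.
have [i gi] : exists i, g i != 0%N.
  apply/existsP; apply: contraPT hg => /existsPn h.
  by rewrite mdegE big1 // => i _; apply/eqP; rewrite -[_ == _]negbK h.
have [g' eg] : exists g', g = (g' + U_(i))%MM.
  by exists (g - U_(i))%MM; rewrite submK ?lep1mP.
subst g; move: hg; rewrite mdegD mdeg1 addn1 => -[hg].
have hN' : (mdeg g' < N)%N by apply: ltn_trans hN; rewrite mdegD mdeg1 addn1.
have hd x : eqtrunc (mdeg g').+1 (mderiv i (taylor N x)) (taylor N (cps_deriv i x)).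
  move=> j; rewrite ltnS => hj.
  have hj1 : (mdeg (j + U_(i)) < N)%N.
    by apply: leq_ltn_trans hN; rewrite !mdegD leq_add2r.
  rewrite mcoeff_mderiv !mcoeff_taylor ?cps_hasseSr //.
  exact: leq_ltn_trans hN'.
(* Multiplied by [(g' i).+1], the coefficient of e^(g' + U_i) becomes that of e^g' in the derivative
   along e_i, where the induction hypothesis applies. *)
apply: (@cps_mulrnI _ _ (g' i)).
rewrite -[RHS]mcoeff_mderiv mderivM mcoeffD.
rewrite (eqtruncM (hd a) eqtrunc_refl) // (eqtruncM eqtrunc_refl (hd b)) //.
rewrite -!IH // -mcoeffD -raddfD -cps_derivM !mcoeff_taylor //.
exact: cps_hasseSr.
Qed.

Lemma taylorC N x : eqtrunc N (taylor N (cpsC d x)) (cpsC d x)%:MP.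
Proof.
move=> g hg; rewrite mcoeff_taylor // mcoeffC.
have [->|g0] := eqVneq g 0%MM; first by rewrite cps_hasse0 mulr1.
rewrite mulr0; apply: cps_coefP => m; rewrite val_hasse val_cpsC mnmD_eq0.
by rewrite (negPf g0) andbF !mulr0.
Qed.

Lemma taylorX N i : eqtrunc N (taylor N (cpsX i)) ((cpsX i)%:MP + 'X_i).
Proof.
move=> g hg; rewrite mcoeff_taylor // mcoeffD mcoeffC mcoeffX.
have [->|g0] := eqVneq g 0%MM.
  by rewrite cps_hasse0 mulr1 mnm1_eq0 addr0.
rewrite mulr0 add0r; apply: cps_coefP => m; rewrite val_hasse val_cpsX.
have -> : val ((U_(i)%MM == g)%:R : cps d) m = ((U_(i)%MM == g) && (m == 0%MM))%:R.
  by case: (U_(i)%MM == g); rewrite ?mulr1n ?cps1E.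
have [->|m0] := eqVneq m 0%MM.
  rewrite add0m andbT /mbin big1 ?mul1r // => j _; exact: binn.
rewrite andbF; case: eqP => [e|]; last by rewrite mulr0.
have := congr1 mdeg e; rewrite mdeg1 mdegD.
by move: g0 m0; rewrite -!mdeg_eq0; case: (mdeg m) => // ?; case: (mdeg g) => // ?; rewrite addnS.
Qed.

(** As g! times the binomial coefficient is a falling factorial, Hasse derivatives of polynomials
    are the entries used in [jac_entry]. *)
Lemma cps_hasse_poly g (p : {mpoly CC[d]}) :
  cps_hasse g (cps_of_poly p) = cps_of_poly ((mfact g)%:R^-1 *: mderivm g p).
Proof.
apply: cps_coefP => m; rewrite val_hasse /= /ps_of_poly.
rewrite mcoeffZ mcoeff_mderivm addmC -(mulr_natl p@_(g + m)) mulrA; congr (_ * _).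
have f0 : (mfact g)%:R != 0 :> CC.
  by rewrite pnatr_eq0 -lt0n; apply: prodn_gt0 => i; exact: fact_gt0.
apply: (mulfI f0); rewrite mulrA divff // mul1r -natrM; congr (_%:R).
by rewrite /mfact /mbin -big_split; apply: eq_bigr => i _ /=; rewrite mulnC bin_ffact.
Qed.

(** Removing the constant term of the jet accounts for the strict inequality [b < c] in
    [jac_entry]. *)
Lemma cps_of_poly_jac_entry N p (b c : 'X_{1..d}) : (mdeg c < N)%N ->
  cps_of_poly (jac_entry p b c) =
  ('X_[b] * (taylor N (cps_of_poly p) - (cps_of_poly p)%:MP))@_c.
Proof.
move=> hc; rewrite mcoeffXM /jac_entry.
have -> : (b < c)%MM = (b != c) && (b <= c)%MM by [].
have [bc|_] := boolP (b <= c)%MM; last by rewrite andbF raddf0.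
have hcb : (mdeg (c - b) < N)%N by apply: leq_ltn_trans hc; apply: mdegB.
have -> : (b != c) = (c - b != 0)%MM.
  congr negb; apply/eqP/eqP => [->|h]; last by rewrite -[c](submK bc) h add0m.
  by apply/mnmP => i; rewrite mnmBE subnn mnm0E.
rewrite mcoeffB mcoeff_taylor // mcoeffC andbT.
case: eqP => [->|_]; first by rewrite cps_hasse0 mulr1 subrr raddf0.
by rewrite mulr0 subr0 cps_hasse_poly.
Qed.
End Taylor.

(** * The chain rule for jets *)

Section TruncOrder.
Variables (d : nat) (R : comNzRingType).
Implicit Types p q : {mpoly R[d]}.

Lemma eqtrunc0M k l p q :
  eqtrunc k p 0 -> eqtrunc l q 0 -> eqtrunc (k + l) (p * q) 0.
Proof.
move=> hp hq m hm; rewrite mcoeff0 mcoeffM big1 // => -[m1 m2] /= /eqP e.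
have [h1|h1] := ltnP (mdeg m1) k; first by rewrite hp // mcoeff0 mul0r.
have [h2|h2] := ltnP (mdeg m2) l; first by rewrite hq // mcoeff0 mulr0.
suff : (mdeg m1 + mdeg m2 < k + l)%N by rewrite ltnNge leq_add.
by rewrite -mdegD -e.
Qed.

Lemma eqtrunc0_mmap1 (h : 'I_d -> {mpoly R[d]}) m :
  (forall i, (h i)@_0%MM = 0) -> eqtrunc (mdeg m) (mmap1 h m) 0.
Proof.
move=> h0; rewrite mdegE /mmap1.
apply: (big_rec2 (fun k p => eqtrunc k p 0)) => // i k p _ hp.
apply: eqtrunc0M hp; elim: (m i) => [|j IH] //.
rewrite exprS -add1n; apply: eqtrunc0M IH => l.
by rewrite ltnS leqn0 mdeg_eq0 => /eqP->; rewrite h0 mcoeff0.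
Qed.

(** Each [h i] has order at least 1, so monomials of degree at least N go to order at least N and do
    not affect the truncation. *)
Lemma eqtrunc_mmap (S : comNzRingType) N (f : {rmorphism S -> {mpoly R[d]}})
    (h : 'I_d -> {mpoly R[d]}) (p q : {mpoly S[d]}) :
  (forall i, (h i)@_0%MM = 0) -> eqtrunc N p q ->
  eqtrunc N (mmap f h p) (mmap f h q).
Proof.
move=> h0 pq k hk; apply/eqP; rewrite -subr_eq0 -mcoeffB -rmorphB /=.
apply/eqP; rewrite /mmap raddf_sum /= big1 // => m _.
have [hm|hm] := ltnP (mdeg m) N.
  by rewrite mcoeffB pq // subrr raddf0 mul0r mcoeff0.
have hf : eqtrunc 0 (f (p - q)@_m) 0 by [].
by rewrite (eqtrunc0M hf (@eqtrunc0_mmap1 _ m h0)) ?mcoeff0 //; apply: leq_trans hk hm.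
Qed.
End TruncOrder.

Section ChainRule.
Variables (d : nat) (phi : {rmorphism cps d -> cps d}).
Hypothesis phiC : forall x, phi (cpsC d x) = cpsC d x.
Implicit Types (a b : cps d) (p q : {mpoly (cps d)[d]}).

(* If phi(X_i) had constant term c <> 0, then X_i - c would be a unit mapped to
   a non-unit. *)
Lemma phiX_const i : val (phi (cpsX i)) 0%MM = 0.
Proof.
set c := val _ _; apply/eqP/negP => /negP c0.
have := congr1 (fun a => val (phi a) 0%MM) (cps_geom i c0).
rewrite rmorphM rmorphB rmorph1 phiC cps1E eqxx cpsME.
rewrite (@psmulE _ 1) ?mdeg0 // mcoeffM.
(* The constant term of the product is the product of the constant terms, and the first of these is
   c - c = 0. *)
rewrite big1; first by move/eqP; rewrite eq_sym oner_eq0.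
move=> [m1 m2] /= /eqP/esym/eqP; rewrite mnmD_eq0 => /andP[/eqP-> /eqP->].
rewrite mcoeff_pstrunc ?mdeg0 //.
rewrite -[X in X * _]/(val (phi (cpsX i)) 0%MM - val (cpsC d c) 0%MM).
by rewrite val_cpsC eqxx mulr1 subrr mul0r.
Qed.

Definition eta N (i : 'I_d) : {mpoly (cps d)[d]} :=
  taylor N (phi (cpsX i)) - (phi (cpsX i))%:MP.

Definition jetmap N : {mpoly (cps d)[d]} -> {mpoly (cps d)[d]} :=
  mmap (@mpolyC d (cps d) \o phi) (eta N).

Lemma jetmap_is_zmod_morphism N : zmod_morphism (jetmap N).
Proof. exact: raddfB. Qed.
Lemma jetmap_is_monoid_morphism N : monoid_morphism (jetmap N).
Proof. by split; [exact: rmorph1|exact: rmorphM]. Qed.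
HB.instance Definition _ N := GRing.isZmodMorphism.Build _ _ (jetmap N)
  (jetmap_is_zmod_morphism N).
HB.instance Definition _ N := GRing.isMonoidMorphism.Build _ _ (jetmap N)
  (jetmap_is_monoid_morphism N).

(** This is what lets [jetmap] respect truncation. The order must be positive: at order 0 the
    truncated jet is 0 and [eta] would be minus the constant phi(x_i). *)
Lemma eta0 N i : (eta N.+1 i)@_0%MM = 0.
Proof.
by rewrite mcoeffB mcoeff_taylor ?mdeg0 // mcoeffC eqxx mulr1 cps_hasse0 subrr.
Qed.

Lemma jetmapC N a : jetmap N a%:MP = (phi a)%:MP.
Proof. exact: mmapC. Qed.

Lemma jetmapX N i : jetmap N 'X_i = eta N i.
Proof. by rewrite /jetmap mmapX mmap1U. Qed.

Lemma eqtrunc_jetmap N p q :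
  eqtrunc N.+1 p q -> eqtrunc N.+1 (jetmap N.+1 p) (jetmap N.+1 q).
Proof. by apply: eqtrunc_mmap => i; exact: eta0. Qed.

(** Membership in the K-th power of the ideal (x, e), modulo e^N, read off the coefficients of total
    degree below K. *)
Definition biord N K p :=
  forall g m, (mdeg g < N)%N -> (mdeg g + mdeg m < K)%N -> val p@_g m = 0.

Lemma biord_eqtrunc N K p q : eqtrunc N p q -> biord N K p -> biord N K q.
Proof. by move=> pq hp g m hg hm; rewrite -pq // hp. Qed.

Lemma biordD N K p q : biord N K p -> biord N K q -> biord N K (p + q).
Proof. by move=> hp hq g m hg hm; rewrite mcoeffD cpsDE hp ?hq ?addr0. Qed.

Lemma biordM N K L p q : biord N K p -> biord N L q -> biord N (K + L) (p * q).
Proof.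
move=> hp hq g m hg hm; rewrite mcoeffM cps_sumE big1 // => -[g1 g2] /= /eqP e.
have e' : mdeg g = (mdeg g1 + mdeg g2)%N by rewrite -mdegD -e.
have h1 : (mdeg g1 < N)%N by apply: leq_ltn_trans hg; exact: leq_trans (leq_addr _ _) (eq_leq (esym e')).
have h2 : (mdeg g2 < N)%N by apply: leq_ltn_trans hg; exact: leq_trans (leq_addl _ _) (eq_leq (esym e')).
rewrite [LHS](congr1 (fun f => f m) (cpsME _ _)) /psmul big1 // => k km.
(* If the first factor has total degree at least K, the second has total degree below L, so one of
   them vanishes. *)
have [hk|hk] := ltnP (mdeg g1 + mdeg k) K.
  by rewrite [X in X * _](hp g1 k) // mul0r.
rewrite [X in _ * X](hq g2) ?mulr0 //.
have e2 : mdeg m = (mdeg (m - k) + mdeg k)%N by rewrite -mdegD submK.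
by clear e; lia.
Qed.

Lemma jetmap_taylorX N i :
  eqtrunc N.+1 (taylor N.+1 (phi (cpsX i))) (jetmap N.+1 (taylor N.+1 (cpsX i))).
Proof.
have := eqtrunc_jetmap (@taylorX _ N.+1 i); rewrite rmorphD /= jetmapC jetmapX.
by rewrite /eta addrC subrK => h; apply: eqtrunc_sym.
Qed.

(* Krull's intersection argument: both sides are ring morphisms agreeing on the
   variables, so they differ by an element of (x, e)^K for every K. *)
Lemma jetmap_taylor N a :
  eqtrunc N.+1 (taylor N.+1 (phi a)) (jetmap N.+1 (taylor N.+1 a)).
Proof.
set S1 := fun a => taylor N.+1 (phi a).
set S2 := fun a => jetmap N.+1 (taylor N.+1 a).
suff h K b : biord N.+1 K (S1 b - S2 b).
  move=> g hg; apply: cps_coefP => m; apply/eqP; rewrite -subr_eq0 -cpsBE -mcoeffB.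
  (* A given coefficient is reached by taking K just above its total degree. *)
  by rewrite (h (mdeg g + mdeg m).+1).
elim: K b => [|K IH] b; first by move=> g m _; rewrite ltn0.
have S1dec : eqtrunc N.+1 (S1 b)
   ((cpsC d (val b 0%MM))%:MP + \sum_i S1 (cpsX i) * S1 (cps_cofactor i b)).
  rewrite {1}(cps_decompose b) /S1 rmorphD raddfD /= phiC [phi (\sum_(i < d) _)]raddf_sum [taylor _ (\sum_(i < d) _)]raddf_sum /=.
  apply: eqtruncD; first exact: taylorC.
  by apply: eqtrunc_sum => i _; rewrite rmorphM; apply: taylorM.
have S2dec : eqtrunc N.+1 (S2 b)
   ((cpsC d (val b 0%MM))%:MP + \sum_i S1 (cpsX i) * S2 (cps_cofactor i b)).
  rewrite {1}(cps_decompose b) /S2 raddfD rmorphD /= [taylor _ (\sum_(i < d) _)]raddf_sum [jetmap _ (\sum_(i < d) _)]raddf_sum /=.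
  apply: eqtruncD.
    by have := eqtrunc_jetmap (@taylorC _ N.+1 (val b 0%MM)); rewrite jetmapC phiC.
  apply: eqtrunc_sum => i _; apply: eqtrunc_trans (eqtrunc_jetmap (@taylorM _ _ _ _)) _.
  rewrite rmorphM; apply: eqtruncM => //.
  by apply: eqtrunc_sym; apply: jetmap_taylorX.
(* The constants cancel. In each remaining product, T(phi x_i) has order at least 1 by [phiX_const]
   and the difference at the cofactor has order at least K by induction. *)
apply: (@biord_eqtrunc _ _ (\sum_i S1 (cpsX i) * (S1 (cps_cofactor i b) - S2 (cps_cofactor i b)))).
  apply: eqtrunc_sym; apply: eqtrunc_trans (eqtruncB S1dec S2dec) _.
  rewrite opprD addrACA subrr add0r -sumrB.
  by apply: eqtrunc_sum => i _; rewrite mulrBr.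
apply: (big_ind (biord N.+1 K.+1)) => [g m _ _|p q|i _]; first by rewrite mcoeff0.
  exact: biordD.
rewrite -[K.+1]add1n; apply: biordM (IH _) => g m hg.
rewrite ltnS leqn0 addn_eq0 !mdeg_eq0 => /andP[/eqP-> /eqP->].
by rewrite mcoeff_taylor ?mdeg0 // cps_hasse0 phiX_const.
Qed.

(** The image modulo e^(N+1) is closed under sums and products, so constants and variables
    suffice. *)
Lemma jetmap_surj (psi : {rmorphism cps d -> cps d}) N p :
  cancel psi phi -> exists q, eqtrunc N.+1 (jetmap N.+1 q) p.
Proof.
move=> psiK.
pose im p := exists q, eqtrunc N.+1 (jetmap N.+1 q) p.
have imC a : im a%:MP by exists (psi a)%:MP; rewrite jetmapC psiK.
have imD q r : im q -> im r -> im (q + r).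
  by move=> [x hx] [y hy]; exists (x + y); rewrite rmorphD; apply: eqtruncD.
have imM q r : im q -> im r -> im (q * r).
  by move=> [x hx] [y hy]; exists (x * y); rewrite rmorphM; apply: eqtruncM.
have imX i : im 'X_i.
  (* By the chain rule this is sent to T(x_i) - x_i, which is e_i. *)
  exists (taylor N.+1 (psi (cpsX i)) - (psi (cpsX i))%:MP).
  rewrite rmorphB /= jetmapC psiK.
  apply: (@eqtrunc_trans _ _ _ (taylor N.+1 (cpsX i) - (cpsX i)%:MP)).
    apply: eqtruncB => //; apply: eqtrunc_sym.
    by have := @jetmap_taylor N (psi (cpsX i)); rewrite psiK.
  apply: eqtrunc_trans (eqtruncB (@taylorX _ _ _) eqtrunc_refl) _.
  by rewrite addrC addKr.
elim/mpolyind: p => [|c m p _ _ hp]; first by rewrite -mpolyC0; exact: imC.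
apply: (imD _ _ _ hp); rewrite -mul_mpolyC; apply: (imM _ _); first exact: imC.
rewrite mpolyXE_id; apply: (big_ind im) => [||i _]; [exact: (imC 1)|exact: imM|].
elim: (m i) => [|k IH]; first exact: (imC 1).
by rewrite exprS; apply: (imM _ _).
Qed.
End ChainRule.

(** * Minors of the Jacobian matrix *)

Definition increasing r c (s : {ffun 'I_r -> 'I_c}) :=
  [forall i : 'I_r, forall j : 'I_r, (i < j)%N ==> (s i < s j)%N].

(** Listing the image of [s] in increasing order gives [t], and the position of [s i] in that list
    gives [p]. This reduces arbitrary column choices to those in [max_minors]. *)
Lemma injective_sort r c (s : {ffun 'I_r -> 'I_c}) : injective s ->
  exists (t : {ffun 'I_r -> 'I_c}) (p : {perm 'I_r}),
    increasing t /\ s =1 t \o p.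
Proof.
move=> sinj; pose E := enum [set s i | i in 'I_r].
have sE : size E = r by rewrite -cardE card_imset // card_ord.
have sinE i : s i \in E by rewrite mem_enum imset_f.
have ssE : sorted ltn (map val E).
  apply: (subseq_sorted ltn_trans _ (iota_ltn_sorted 0 c)).
  by rewrite -val_enum_ord map_subseq // /E enumT filter_subseq.
have pb i : (index (s i) E < r)%N by rewrite -[X in (_ < X)%N]sE index_mem.
have pinj : injective (fun i => Ordinal (pb i)).
  move=> i j /(congr1 val) /= h; apply: sinj.
  by rewrite -[s i](nth_index (s i) (sinE i)) h nth_index.
exists [ffun i : 'I_r => nth (s i) E i], (perm pinj); split; last first.
  move=> i /=; rewrite ffunE permE /= (set_nth_default (s i)) ?nth_index //.
  by rewrite sE pb.
apply/forallP => i; apply/forallP => j; apply/implyP => ij; rewrite !ffunE.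
have hE k (x : 'I_c) : (k < r)%N -> val (nth x E k) = nth 0 (map val E) k.
  by move=> hk; rewrite (nth_map x) ?sE.
rewrite [X in (X < _)%N](hE i (s i) (ltn_ord i)) [X in (_ < X)%N](hE j (s j) (ltn_ord j)).
by apply: (sorted_ltn_nth ltn_trans 0%N ssE); rewrite ?inE ?size_map ?sE ?ltn_ord.
Qed.

(** * Determinants modulo an ideal, and Cauchy-Binet *)

Section Ideals.
Variable R : comNzRingType.

Record is_ideal (J : R -> Prop) : Prop := IsIdeal {
  ideal0 : J 0;
  idealD : forall a b, J a -> J b -> J (a + b);
  idealM : forall a b, J b -> J (a * b) }.

Variables (J : R -> Prop) (idJ : is_ideal J).

Lemma ideal_sum (I : Type) (r : seq I) (P : pred I) F :
  (forall i, P i -> J (F i)) -> J (\sum_(i <- r | P i) F i).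
Proof. by move=> h; apply: (big_ind J) => //; [exact: ideal0|exact: idealD]. Qed.

Lemma ideal_prodB (I : Type) (r : seq I) (P : pred I) F G :
  (forall i, J (F i - G i)) ->
  J (\prod_(i <- r | P i) F i - \prod_(i <- r | P i) G i).
Proof.
move=> h; apply: (big_rec2 (fun x y => J (x - y))) => [|i x y _ hxy].
  by rewrite subrr; exact: ideal0.
rewrite (_ : _ - _ = F i * (x - y) + y * (F i - G i)); last by ring.
by apply: idealD => //; apply: idealM.
Qed.

Lemma ideal_detB n (M N : 'M[R]_n) :
  (forall i j, J (M i j - N i j)) -> J (\det M - \det N).
Proof.
move=> h; rewrite -sumrB; apply: ideal_sum => s _; rewrite -mulrBr.
by apply: idealM => //; apply: ideal_prodB.
Qed.

(** Cauchy-Binet before grouping: distributing the product over the sums leaves all maps [s],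
    injective or not. *)
Lemma det_mulmx_sum r c (M : 'M[R]_(r, c)) (N : 'M[R]_(c, r)) :
  \det (M *m N) =
  \sum_(s : {ffun 'I_r -> 'I_c}) (\prod_i N (s i) i) * \det (colsub s M).
Proof.
rewrite -[LHS]det_tr [LHS]/determinant.
under eq_bigr => p _.
  under eq_bigr => i _ do rewrite !mxE.
  rewrite bigA_distr_bigA /= mulr_sumr.
  over.
rewrite exchange_big; apply: eq_bigr => s _.
rewrite -det_tr /determinant mulr_sumr; apply: eq_bigr => p _.
rewrite big_split /= mulrA [RHS]mulrC; congr (_ * _ * _).
by apply: eq_bigr => i _; rewrite !mxE.
Qed.

(** A non-injective [s] repeats a column and contributes 0; an injective one gives an increasing
    minor up to sign. *)
Lemma ideal_det_mulmx r c (M : 'M[R]_(r, c)) (N : 'M[R]_(c, r)) :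
  (forall s : {ffun 'I_r -> 'I_c}, increasing s -> J (\det (colsub s M))) ->
  J (\det (M *m N)).
Proof.
move=> h; rewrite det_mulmx_sum; apply: ideal_sum => s _; apply: idealM => //.
have [/injectiveP sinj|/injectivePn[i [j ij sij]]] := boolP (injectiveb s); last first.
  rewrite -det_tr (determinant_alternate ij) => [|k]; first exact: ideal0.
  by rewrite !mxE sij.
have [t [p [tinc tp]]] := injective_sort sinj.
have -> : colsub s M = col_perm p (colsub t M).
  by apply/matrixP => i j; rewrite !mxE tp.
by rewrite col_permE det_mulmx mulrC; apply: idealM => //; exact: h.
Qed.
End Ideals.

(** * Factorization of the Jacobian matrix under contact equivalence *)

Section MinorIdeal.
Variables (d n : nat) (phi psi : {rmorphism cps d -> cps d}).
Hypotheses (phiC : forall x, phi (cpsC d x) = cpsC d x) (psiK : cancel psi phi).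
Variables (f g : {mpoly CC[d]}) (u : cps d).
Hypothesis gE : cps_of_poly g = u * phi (cps_of_poly f).

Definition row_exp (i : 'I_#|{: jac_row d n}|) : 'X_{1..d} :=
  bmnm (enum_val i : jac_row d n).
Definition col_exp (j : 'I_#|{: jac_col d n}|) : 'X_{1..d} :=
  bmnm (val (enum_val j : jac_col d n)).

Lemma mdeg_col_exp j : (mdeg (col_exp j) < n.+1)%N.
Proof. exact: bmdeg. Qed.

Definition cps_Jac h := map_mx (@cps_of_poly d) (Jac n h).
Definition delta (a : cps d) := taylor n.+1 a - a%:MP.

Lemma delta0 a : eqtrunc 1 (delta a) 0.
Proof.
move=> m; rewrite ltnS leqn0 mdeg_eq0 => /eqP->.
by rewrite mcoeffB mcoeff_taylor ?mdeg0 // mcoeffC eqxx mulr1 cps_hasse0 subrr mcoeff0.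
Qed.

Lemma cps_JacE h i j :
  cps_Jac h i j = ('X_[row_exp i] * delta (cps_of_poly h))@_(col_exp j).
Proof. by rewrite !mxE (@cps_of_poly_jac_entry _ n.+1) // mdeg_col_exp. Qed.

(** The columns omit degree 0, where nothing is lost because [delta] has no constant term. *)
Lemma mulX_delta h i :
  eqtrunc n.+1 ('X_[row_exp i] * delta (cps_of_poly h))
    (\sum_j cps_Jac h i j *: 'X_[col_exp j]).
Proof.
move=> k hk; rewrite raddf_sum /=.
have [k0|k0] := posnP (mdeg k).
  rewrite (eqtrunc0M (k := 0) (l := 1) (fun _ => _) (@delta0 _)) ?k0 ?mcoeff0 //.
  rewrite big1 // => j _; rewrite mcoeffZ mcoeffX.
  case: eqP => [e|_]; last by rewrite mulr0.
  by have := valP (enum_val j : jac_col d n); rewrite -[bmnm _]/(col_exp j) e k0.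
pose x : jac_col d n := exist _ (BMultinom hk) k0.
rewrite (bigD1 (enum_rank x)) //= big1 ?addr0 => [|j jx].
  by rewrite mcoeffZ mcoeffX cps_JacE /col_exp enum_rankK eqxx mulr1.
rewrite mcoeffZ mcoeffX; case: eqP => [e|_]; last by rewrite mulr0.
case/eqP: jx; rewrite -[j]enum_valK; congr enum_rank.
by do 2 apply: val_inj.
Qed.

(** Since [delta] has order at least 1, only [q] modulo e^n matters; hence the rows of degree below
    n suffice. *)
Lemma mul_delta h q :
  eqtrunc n.+1 (q * delta (cps_of_poly h))
    (\sum_j (\sum_i q@_(row_exp i) * cps_Jac h i j) *: 'X_[col_exp j]).
Proof.
pose q' := \sum_i q@_(row_exp i) *: 'X_[row_exp i] : {mpoly (cps d)[d]}.
have qq' : eqtrunc n (q - q') 0.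
  move=> k hk; rewrite mcoeffB /q' raddf_sum /= (bigD1 (enum_rank (BMultinom hk : jac_row d n))) //=.
  rewrite big1 ?addr0 => [|i ix].
    by rewrite mcoeffZ mcoeffX /row_exp enum_rankK eqxx mulr1 subrr mcoeff0.
  rewrite mcoeffZ mcoeffX; case: eqP => [e|_]; last by rewrite mulr0.
  case/eqP: ix; rewrite -[i]enum_valK; congr enum_rank.
  by apply: val_inj.
apply: (@eqtrunc_trans _ _ _ (q' * delta (cps_of_poly h))).
  rewrite -[q](subrK q') mulrDl -[X in eqtrunc _ _ X]add0r.
  apply: eqtruncD => //; rewrite -addn1; apply: eqtrunc0M => //.
  exact: delta0.
rewrite /q' mulr_suml.
apply: (@eqtrunc_trans _ _ _ (\sum_i q@_(row_exp i) *: (\sum_j cps_Jac h i j *: 'X_[col_exp j]))).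
  apply: eqtrunc_sum => i _; rewrite -!mul_mpolyC -mulrA.
  by apply: eqtruncM => //; exact: mulX_delta.
under eq_bigr => i _ do rewrite scaler_sumr.
rewrite exchange_big /=; apply: eqtrunc_sum => j _.
by rewrite scaler_suml; under eq_bigr => i _ do rewrite scalerA.
Qed.

(* delta g = T(u) Phi(delta f) + phi(f) (T(u) - u) modulo e^(n+1). *)
Lemma cps_Jac_factor :
  exists (C : 'M_(_, _)) (E : 'M_(_, _)) (X : 'M_(_, _)),
    cps_Jac g = C *m map_mx phi (cps_Jac f) *m E + phi (cps_of_poly f) *: X.
Proof.
have gF := gE; set F := cps_of_poly f in gF *.
(* Lifting e^b T(u) through Phi puts all of the first summand inside Phi, as the image of q_i (T(f)
   - f). *)
have /fin_all_exists[q hq] i : exists q,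
    eqtrunc n.+1 (jetmap phi n.+1 q) ('X_[row_exp i] * taylor n.+1 u).
  exact: jetmap_surj psiK.
(* [C] holds the coefficients of the lifts, and [E] is the matrix of Phi on the monomials indexing
   the columns. *)
exists (\matrix_(i, k) phi (q i)@_(row_exp k)).
exists (\matrix_(l, j) (jetmap phi n.+1 'X_[col_exp l])@_(col_exp j)).
exists (\matrix_(i, j) ('X_[row_exp i] * delta u)@_(col_exp j)).
apply/matrixP => i j; rewrite cps_JacE gF.
have h1 : eqtrunc n.+1 ('X_[row_exp i] * delta (u * phi F))
   (jetmap phi n.+1 (q i * delta F) + (phi F)%:MP * ('X_[row_exp i] * delta u)).
  apply: (@eqtrunc_trans _ _ _ ('X_[row_exp i] * (taylor n.+1 u * taylor n.+1 (phi F) - u%:MP * (phi F)%:MP))).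
    by apply: eqtruncM => //; apply: eqtruncB; [exact: taylorM|rewrite mpolyCM].
  rewrite (_ : _ * (_ - _) = ('X_[row_exp i] * taylor n.+1 u) * delta (phi F)
     + (phi F)%:MP * ('X_[row_exp i] * delta u)); last by rewrite /delta; ring.
  apply: eqtruncD => //; rewrite rmorphM; apply: eqtruncM.
    exact: eqtrunc_sym (hq i).
  by rewrite /delta rmorphB /= jetmapC; apply: eqtruncB => //; exact: jetmap_taylor.
rewrite h1 ?mdeg_col_exp // mcoeffD mcoeffCM !mxE; congr (_ + _).
rewrite (eqtrunc_jetmap phi (mul_delta f (q i))) ?mdeg_col_exp // [jetmap _ _ _]raddf_sum raddf_sum /=.
apply: eq_bigr => l _; rewrite -mul_mpolyC rmorphM /= jetmapC mcoeffCM !mxE.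
congr (_ * _); rewrite rmorph_sum; apply: eq_bigr => k _.
by rewrite rmorphM !mxE.
Qed.

Lemma minor_in_ideal (J : cps d -> Prop) : is_ideal J ->
  J (phi (cps_of_poly f)) ->
  (forall s, increasing s -> J (phi (cps_of_poly (\det (colsub s (Jac n f)))))) ->
  forall s : {ffun _ -> _}, J (cps_of_poly (\det (colsub s (Jac n g)))).
Proof.
move=> idJ Jf JM s.
have [C [E [X JE]]] := cps_Jac_factor.
rewrite -det_map_mx; set D := \det _.
(* Modulo phi(f), which lies in [J], the chosen columns of Jac_n(g) are those of the triple
   product. *)
have -> : D = (D - \det (C *m (map_mx phi (cps_Jac f) *m colsub s E)))
   + \det (C *m (map_mx phi (cps_Jac f) *m colsub s E)) by rewrite subrK.
apply: idealD => //.
  apply: ideal_detB => // i j.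
  have -> : map_mx (@cps_of_poly d) (colsub s (Jac n g)) i j = cps_Jac g i (s j) by rewrite !mxE.
  have addB (A B : 'M[cps d]_(_, _)) : (A + B) i (s j) - colsub s A i j = B i (s j) :> cps d.
    by rewrite !mxE addrC addKr.
  by rewrite JE mulmxA mulmx_colsub addB mxE mulrC; apply: idealM.
(* [C] is square, so its determinant factors out; Cauchy-Binet handles the rest. *)
rewrite det_mulmx; apply: idealM => //; apply: ideal_det_mulmx => // t tinc.
rewrite (_ : colsub t _ = map_mx phi (map_mx (@cps_of_poly d) (colsub t (Jac n f)))).
  by rewrite !det_map_mx; exact: JM.
by apply/matrixP => i j; rewrite !mxE.
Qed.
End MinorIdeal.

(** * Transport of the ideals *)

Section IdealGen.
Variable d : nat.
Implicit Types (a b : cps d) (l : seq {mpoly CC[d]}).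

Lemma ideal_gen_nil (a : ps d) : ideal_gen [::] a <-> a = 0.
Proof.
split=> [[[|c cs] [//= _ _] ->] //|->].
by exists [::].
Qed.

Lemma ideal_gen_cons (x : ps d) gens (a : ps d) :
  ideal_gen (x :: gens) a <->
  exists c b : ps d, [/\ convergent c, ideal_gen gens b & a = psadd (psmul c x) b].
Proof.
split=> [[[|c cs] [//= [sz] cc] ->]|[c [b [cc [cs [sz ccs] ->] ->]]]].
  exists c, (foldr (fun pq acc => psadd (psmul pq.1 pq.2) acc) (@ps0 d) (zip cs gens)).
  split=> //; first exact: (cc 0%N).
  by exists cs; split=> // k; apply: (cc k.+1).
exists (c :: cs); split=> //=; first by rewrite sz.
by case=> //= k; apply: ccs.
Qed.

(** For the list [f :: max_minors n f] this is [f_jac_ideal n f] at [val a] by unfolding, now a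
    predicate on the ring [cps d]. *)
Definition poly_ideal l a := ideal_gen (map (@ps_of_poly d) l) (val a).

Lemma poly_ideal_cons p l a :
  poly_ideal (p :: l) a <->
  exists c b, poly_ideal l b /\ a = c * cps_of_poly p + b.
Proof.
rewrite /poly_ideal /= ideal_gen_cons; split=> [[c [b [cc hb e]]]|[c [b [hb ->]]]].
  (* The remainder is a difference of convergent series, hence comes from [cps d]. *)
  have eb : b = val (a - mkcps cc * cps_of_poly p).
    apply/funext => m; rewrite cpsBE [val a]e cpsME /psadd addrC addKr //.
  by exists (mkcps cc), (a - mkcps cc * cps_of_poly p); rewrite -eb addrC subrK.
by exists (val c), (val b); split=> //; exact: cps_convergent.
Qed.

Lemma poly_ideal_is_ideal l : is_ideal (poly_ideal l).
Proof.
elim: l => [|p l IH].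
  split=> [|a b /ideal_gen_nil ha /ideal_gen_nil hb|a b /ideal_gen_nil hb].
  - exact/ideal_gen_nil.
  - by apply/ideal_gen_nil; rewrite rmorphD /= ha hb addr0.
  - by apply/ideal_gen_nil; rewrite rmorphM /= hb mulr0.
split=> [|a b /poly_ideal_cons[c [a' [ha ->]]] /poly_ideal_cons[e [b' [hb ->]]]
  |a b /poly_ideal_cons[c [b' [hb ->]]]]; apply/poly_ideal_cons.
- by exists 0, 0; split; [exact: ideal0|rewrite mul0r addr0].
- exists (c + e), (a' + b'); split; first exact: idealD.
  by rewrite mulrDl addrACA.
- exists (a * c), (a * b'); split; first exact: idealM.
  by rewrite mulrDr mulrA.
Qed.

Lemma poly_ideal_gen l p : p \in l -> poly_ideal l (cps_of_poly p).
Proof.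
elim: l => // q l IH; rewrite inE => /predU1P[->|/IH h]; apply/poly_ideal_cons.
  exists 1, 0; split; last by rewrite mul1r addr0.
  exact: ideal0 (poly_ideal_is_ideal l).
by exists 0, (cps_of_poly p); rewrite mul0r add0r.
Qed.

Lemma poly_ideal_min l (J : cps d -> Prop) : is_ideal J ->
  (forall p, p \in l -> J (cps_of_poly p)) -> forall a, poly_ideal l a -> J a.
Proof.
move=> idJ; elim: l => [|p l IH] h a.
  move=> /ideal_gen_nil e; rewrite (_ : a = 0); first exact: ideal0.
  exact: val_inj.
move/poly_ideal_cons => [c [b [hb ->]]]; apply: idealD => //.
  by apply: idealM => //; apply: h; rewrite mem_head.
by apply: IH hb => q ql; apply: h; rewrite inE ql orbT.
Qed.

Lemma preim_is_ideal (phi : {rmorphism cps d -> cps d}) (J : cps d -> Prop) :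
  is_ideal J -> is_ideal (fun a => J (phi a)).
Proof.
move=> idJ; split=> [|a b ha hb|a b hb].
- by rewrite rmorph0; apply: ideal0.
- by rewrite rmorphD; apply: idealD.
- by rewrite rmorphM; apply: idealM.
Qed.

Lemma mem_max_minors n (h p : {mpoly CC[d]}) :
  reflect (exists2 s, increasing s & p = \det (colsub s (Jac n h)))
    (p \in max_minors n h).
Proof.
apply: (iffP mapP) => -[s hs ->]; exists s => //; first by move: hs; rewrite mem_enum.
by rewrite mem_enum.
Qed.
End IdealGen.

Section Transport.
Variables (d n : nat) (phi psi : {rmorphism cps d -> cps d}).
Hypotheses (phiC : forall x, phi (cpsC d x) = cpsC d x) (psiK : cancel psi phi).
Variables (f g : {mpoly CC[d]}) (u : cps d).
Hypothesis gE : cps_of_poly g = u * phi (cps_of_poly f).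

(** It suffices to treat generators: [g] is a multiple of phi(f), and the minors are
    [minor_in_ideal]. A general [J] allows preimages of ideals, as both inclusions of the theorem
    require. *)
Lemma poly_ideal_transport (J : cps d -> Prop) : is_ideal J ->
  (forall a, poly_ideal (f :: max_minors n f) a -> J (phi a)) ->
  forall a, poly_ideal (g :: max_minors n g) a -> J a.
Proof.
move=> idJ h.
have Jf : J (phi (cps_of_poly f)) by apply: h; apply: poly_ideal_gen; rewrite mem_head.
apply: poly_ideal_min => // p; rewrite inE => /predU1P[->|/mem_max_minors[s _ ->]].
  by rewrite gE; apply: idealM.
apply: (minor_in_ideal phiC psiK gE idJ Jf) => t tinc.
apply/h/poly_ideal_gen; rewrite inE; apply/orP; right.
by apply/mem_max_minors; exists t.
Qed.
End Transport.

(** * Algebra automorphisms as invertible ring morphisms *)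

Section AutomorphismOnCps.
Variable d : nat.

(** [phi] is controlled only on convergent series, so it is restricted to them. Constants are fixed
    as scalar multiples of 1. *)
Lemma cps_automorphism_rmorphism (phi : ps d -> ps d) : cps_automorphism phi ->
  exists Phi : {rmorphism cps d -> cps d},
    (forall a, val (Phi a) = phi (val a)) /\ (forall x, Phi (cpsC d x) = cpsC d x).
Proof.
move=> [hc [hD [hM [hZ [h1 _]]]]].
pose F a := mkcps (hc _ (cps_convergent a)) : cps d.
have FD a b : F (a + b) = F a + F b.
  by apply: val_inj; rewrite [LHS]hD //; exact: cps_convergent.
have Fadd : zmod_morphism F.
  by move=> a b; apply: (addIr (F b)); rewrite -FD !subrK.
have Fmul : monoid_morphism F.
  split=> [|a b]; apply: val_inj; first exact: h1.
  by rewrite [LHS]hM //; exact: cps_convergent.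
pose mA := GRing.isZmodMorphism.Build _ _ F Fadd.
pose mM := GRing.isMonoidMorphism.Build _ _ F Fmul.
pose Phi : {rmorphism cps d -> cps d} := HB.pack F mA mM.
exists Phi; split=> // x.
have vC : val (cpsC d x) = psscale x (@ps1 d).
  by apply/funext => m; rewrite val_cpsC -[@ps1 d]/(1 : ps d) /psscale ps1E.
apply: val_inj; rewrite [LHS](_ : _ = phi (val (cpsC d x))) // vC hZ ?h1 //.
exact: (cps_convergent (1 : cps d)).
Qed.

(** The inverse comes from choice; its morphism laws are checked after applying the injective
    [Phi]. *)
Lemma rmorphism_inverse (Phi : {rmorphism cps d -> cps d}) :
  injective Phi -> (forall b, exists a, Phi a = b) ->
  exists Psi : {rmorphism cps d -> cps d}, cancel Phi Psi /\ cancel Psi Phi.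
Proof.
move=> inj /choice[F FK].
have Fadd : zmod_morphism F by move=> a b; apply: inj; rewrite rmorphB !FK.
have Fmul : monoid_morphism F.
  by split=> [|a b]; apply: inj; rewrite ?rmorph1 ?rmorphM !FK.
pose mA := GRing.isZmodMorphism.Build _ _ F Fadd.
pose mM := GRing.isMonoidMorphism.Build _ _ F Fmul.
pose Psi : {rmorphism cps d -> cps d} := HB.pack F mA mM.
by exists Psi; split=> a; [apply: inj; rewrite FK|exact: FK].
Qed.

End AutomorphismOnCps.

Theorem theorem2p24 (d : nat) (f g : {mpoly CC[d]}) :
  f@_0%MM = 0 -> g@_0%MM = 0 ->
  (exists (phi : ps d -> ps d) (u : ps d),
      cps_automorphism phi /\ cps_unit u /\
      ps_of_poly g = psmul u (phi (ps_of_poly f))) ->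
  forall n : nat, (1 <= n)%N ->
    quotient_algebras_iso (f_jac_ideal n f) (f_jac_ideal n g).
Proof.
move=> _ _ [phi [u [aut [[cu [v cv uv1]] gE]]]] n _.
have [hc [hD [hM [hZ [h1 [hinj hsurj]]]]]] := aut.
have [Phi [PhiE PhiC]] := cps_automorphism_rmorphism aut.
have Phi_inj : injective Phi.
  move=> a b /(congr1 val); rewrite !PhiE => e; apply/val_inj/hinj => //;
  exact: cps_convergent.
have [|Psi [PhiK PsiK]] := rmorphism_inverse Phi_inj.
  move=> b; have [a ca ab] := hsurj _ (cps_convergent b).
  by exists (mkcps ca); apply: val_inj; rewrite PhiE.
have PsiC x : Psi (cpsC d x) = cpsC d x by rewrite -{1}(PhiC x) PhiK.
pose U := mkcps cu; pose V := mkcps cv.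
have UV1 : U * V = 1 by apply: val_inj; rewrite rmorphM; exact: uv1.
have gE' : cps_of_poly g = U * Phi (cps_of_poly f).
  by apply: val_inj; rewrite rmorphM /= PhiE; exact: gE.
(* The symmetric relation: f is Psi(u^-1) times Psi(g). *)
have fE' : cps_of_poly f = Psi V * Psi (cps_of_poly g).
  by rewrite -rmorphM gE' mulrA [V * U]mulrC UV1 mul1r PhiK.
pose I := poly_ideal (f :: max_minors n f).
pose J := poly_ideal (g :: max_minors n g).
have idI : is_ideal I by exact: poly_ideal_is_ideal.
have idJ : is_ideal J by exact: poly_ideal_is_ideal.
(* The symmetric relation, used with the preimage of [J] under [Phi] as target ideal. *)
have IJ a : I a -> J (Phi a).
  move: a; apply: (poly_ideal_transport PsiC PhiK fE' (preim_is_ideal Phi idJ)) => a Ja.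
  by rewrite /= PsiK.
(* The original relation, used with the preimage of [I] under [Psi] as target ideal. *)
have JI a : J (Phi a) -> I a.
  rewrite -{2}(PhiK a); move: (Phi a).
  apply: (poly_ideal_transport PhiC PsiK gE' (preim_is_ideal Psi idI)) => b Ib.
  by rewrite /= PhiK.
have J0 : f_jac_ideal n g (@ps0 d) by exact: (ideal0 idJ).
have subss (a : ps d) : pssub a a = @ps0 d.
  by apply/funext => m; rewrite /pssub /psadd /psopp subrr.
(* [phi] itself serves on representatives; it preserves the operations exactly, so each difference
   to be tested for membership is 0. *)
exists phi; split; first exact: hc.
split.
  move=> a a' ca ca' /(IJ (mkcps ca - mkcps ca')).
  by rewrite rmorphB /J /poly_ideal rmorphB /= !PhiE.
split; first by move=> a b ca cb; rewrite hD // subss.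
split; first by move=> a b ca cb; rewrite hM // subss.
split; first by move=> c a ca; rewrite hZ // subss.
split; first by rewrite h1 subss.
split.
  move=> a a' ca ca' h; apply: (JI (mkcps ca - mkcps ca')).
  by rewrite rmorphB /J /poly_ideal rmorphB /= !PhiE.
by move=> b cb; have [a ca <-] := hsurj b cb; exists a => //; rewrite subss.
Qed.
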